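(* Fix $u \in C([0,T],\mathbb{R}^m)$. For every $w=(J,R,Q,B,x_0) \in \mathcal{U}_{\mathrm{ad}}$ the initial value problem $$\frac{d}{dt} x(t) = (J-R)Q\,x(t) + B u(t),\quad t\in[0,T], \qquad x(0)=x_0,$$ (with output $y = B^\top Q x$) admits a unique solution $x\in C^1([0,T],\mathbb{R}^n)$. Moreover, the solution depends continuously on the data: for $w, w' \in \mathcal{U}_{\mathrm{ad}}$ with corresponding solutions $x,x'$ (for the same input $u$), there exists a constant $C>0$ such that $$\| x - x' \|_{H^1((0,T),\mathbb{R}^n)} \le C\, \|w-w'\|_{\mathcal{U}_{\mathrm{ad}}}.$$
   Context: Let $T>0$ and $n,m\in\mathbb{N}$. The parameter space is $W = \mathbb{R}^{n\times n} \times \mathbb{R}^{n\times n} \times \mathbb{R}^{n\times n} \times \mathbb{R}^{n\times m} \times \mathbb{R}^n$ with its Euclidean norm. The set of admissible parameters is a set $$\mathcal{U}_{\mathrm{ad}} \subseteq \{ w = (J,R,Q,B,x_0) \in W : J^\top = -J,\ R \succcurlyeq 0,\ Q \succ 0 \},$$ where $R \succcurlyeq 0$ means symmetric positive semidefinite and $Q\succ 0$ means symmetric positive definite. $\|w-w'\|_{\mathcal{U}_{\mathrm{ad}}}$ denotes the norm of $w-w'$ in $W$. *)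

(* Defs.v *)
From HB Require Import structures.
From mathcomp Require Import all_boot all_order all_algebra.
From mathcomp Require Import all_classical all_reals all_analysis.

Set Implicit Arguments.
Unset Strict Implicit.
Unset Printing Implicit Defensive.

Import Order.TTheory GRing.Theory Num.Theory.
Import numFieldNormedType.Exports.

Local Open Scope classical_set_scope.
Local Open Scope ring_scope.

(* The library norm `|A| on matrices is the max norm, hence this one. *)
Definition frob (R : realType) (p q : nat) (A : 'M[R]_(p, q)) : R :=
  Num.sqrt (\sum_i \sum_j (A i j) ^+ 2).

(* W, with w = (J, R, Q, B, x0); a notation, so that the library's group
   structure on products applies. *)
Notation param R n m :=
  ('M[R]_n * 'M[R]_n * 'M[R]_n * 'M[R]_(n, m) * 'cV[R]_n)%type (only parsing).

Section Param.
Variables (R : realType) (n m : nat).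
Implicit Types w : param R n m.

Definition wJ w : 'M[R]_n := w.1.1.1.1.
Definition wR w : 'M[R]_n := w.1.1.1.2.
Definition wQ w : 'M[R]_n := w.1.1.2.
Definition wB w : 'M[R]_(n, m) := w.1.2.
Definition wx0 w : 'cV[R]_n := w.2.

Definition wnorm w : R :=
  Num.sqrt (frob (wJ w) ^+ 2 + frob (wR w) ^+ 2 + frob (wQ w) ^+ 2
            + frob (wB w) ^+ 2 + frob (wx0 w) ^+ 2).

Definition sym_psd (A : 'M[R]_n) : Prop :=
  A^T = A /\ forall v : 'cV[R]_n, 0 <= (v^T *m A *m v) 0 0.

Definition sym_pd (A : 'M[R]_n) : Prop :=
  A^T = A /\ forall v : 'cV[R]_n, v != 0 -> 0 < (v^T *m A *m v) 0 0.

Definition ph_param : set (param R n m) :=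
  [set w | [/\ (wJ w)^T = - wJ w, sym_psd (wR w) & sym_pd (wQ w)]].

End Param.

Section Solutions.
Variables (R : realType) (T : R).

(* Derivative relative to `[0, T]: one-sided at the endpoints. *)
Definition is_derive_on (V : normedModType R) (f : R -> V) (t : R) (d : V)
    : Prop :=
  (s - t)^-1 *: (f s - f t) @[s --> within `[0, T] t^'] --> d.

Definition C1_on (V : normedModType R) (f : R -> V) : Prop :=
  exists2 df : R -> V, {within `[0, T], continuous df} &
    forall t, t \in `[0, T] -> is_derive_on f t (df t).

(* Only the values of x on `[0, T] matter. *)
Definition ph_solution (n m : nat) (u : R -> 'cV[R]_m) (w : param R n m)
    (x : R -> 'cV[R]_n) : Prop :=
  [/\ C1_on x,
      forall t, t \in `[0, T] ->
        is_derive_on x t ((wJ w - wR w) *m wQ w *m x t + wB w *m u t)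
    & x 0 = wx0 w].

End Solutions.

Section Sobolev.
Variables (R : realType) (T : R).

Definition test_function (phi : R -> R) : Prop :=
  (forall (k : nat) (t : R), derivable (derive1n k phi) t 1) /\
  exists a b : R, [/\ 0 < a, b < T &
    forall t, t \notin `[a, b] -> phi t = 0].

Definition weak_derivative (f g : R -> R) : Prop :=
  [/\ locally_integrable `]0, T[ f, locally_integrable `]0, T[ g &
    forall phi, test_function phi ->
      \int[lebesgue_measure]_(t in `]0, T[) (f t * derive1 phi t) =
      - \int[lebesgue_measure]_(t in `]0, T[) (g t * phi t)].

(* The norm of H^1((0, T), R^n), extended by +oo to functions outside that
   space. A weak derivative is unique almost everywhere, so all members of the
   set below are equal; the set is empty when f has no weak derivative. *)
Definition H1norm (n : nat) (f : R -> 'cV[R]_n) : \bar R :=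
  ereal_inf [set N : \bar R | exists2 g : R -> 'cV[R]_n,
    (forall i, weak_derivative (fun t => f t i 0) (fun t => g t i 0)) &
    N = poweR (\int[lebesgue_measure]_(t in `]0%R, T[)
                 (frob (f t) ^+ 2 + frob (g t) ^+ 2)%R%:E)%E 2^-1].

End Sobolev.

(* Main.v *)
Require Import Defs.
From mathcomp Require Import all_boot all_order all_algebra.
From mathcomp Require Import all_classical all_reals all_analysis.
From mathcomp Require Import measurable_realfun ring lra.

(* With A = (J - R) Q, the solution is given by variation of constants:
   x(t) = e^(tA) (x0 + int_0^t e^(-sA) B u(s) ds), where u is extended to R by
   the constants u(0) and u(T). The difference z of two solutions satisfies
   z' = A z + r with r = (A - A') x' + (B - B') u. As
   d/dt |z|^2 <= K |z|^2 + n rho^2 when |r| <= rho, the function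
   e^(-Kt) (|z|^2 + n rho^2) is nonincreasing, which bounds z by a multiple of
   |z(0)| + rho. This gives uniqueness (r = 0, z(0) = 0), a bound on x' in terms
   of M (A' and B' u in place of A and r), and then z, z' = O(|w - w'|)
   uniformly on [0, T]; the classical derivative z' is the weak one. *)

Set Implicit Arguments.
Unset Strict Implicit.
Unset Printing Implicit Defensive.

Import Order.TTheory GRing.Theory Num.Theory.
Import numFieldNormedType.Exports.
Local Open Scope classical_set_scope.
Local Open Scope ring_scope.

(** * Max norm and Frobenius norm of matrices, entrywise limits *)

Section MatrixNorm.
Context {R : realType}.

Lemma le_mx_entry p q (A : 'M[R]_(p, q)) i j : `|A i j| <= `|A|.
Proof.
rewrite [leRHS]/Num.norm /= mx_normrE; apply/bigmax_geP; right => /=.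
by exists (i, j).
Qed.

Lemma mx_norm_le p q (A : 'M[R]_(p, q)) e : 0 <= e ->
  (forall i j, `|A i j| <= e) -> `|A| <= e.
Proof.
move=> e0 Ae; rewrite [leLHS]/Num.norm /= mx_normrE.
by apply/bigmax_leP; split=> // -[i j] _ /=.
Qed.

(** An entry of the product is a sum of [q] terms, so the max norm is submultiplicative only up to
    the inner dimension; this is where the factors [n] and [m] in later bounds come from. *)
Lemma mx_normM_le p q r (A : 'M[R]_(p, q)) (B : 'M[R]_(q, r)) :
  `|A *m B| <= q%:R * `|A| * `|B|.
Proof.
apply: mx_norm_le => [|i j]; first by rewrite !mulr_ge0.
rewrite mxE (le_trans (ler_norm_sum _ _ _))//.
have -> : q%:R * `|A| * `|B| = \sum_(k < q) `|A| * `|B|.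
  by rewrite sumr_const card_ord -mulrA mulr_natl.
rewrite ler_sum// => k _; by rewrite normrM ler_pM// le_mx_entry.
Qed.

Lemma frob_ge0 p q (A : 'M[R]_(p, q)) : 0 <= frob A.
Proof. exact: sqrtr_ge0. Qed.

Lemma frobE p q (A : 'M[R]_(p, q)) :
  frob A ^+ 2 = \sum_i \sum_j (A i j) ^+ 2.
Proof.
by rewrite sqr_sqrtr// sumr_ge0// => i _; rewrite sumr_ge0// => j _; exact: sqr_ge0.
Qed.

Lemma mx_norm_le_frob p q (A : 'M[R]_(p, q)) : `|A| <= frob A.
Proof.
apply: mx_norm_le => [|i j]; first exact: frob_ge0.
rewrite -(@ler_pXn2r _ 2)// ?nnegrE ?frob_ge0// frobE real_normK ?num_real//.
rewrite (bigD1 i)//= (bigD1 j)//= -addrA lerDl addr_ge0// sumr_ge0// => k _.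
  exact: sqr_ge0.
by rewrite sumr_ge0// => l _; exact: sqr_ge0.
Qed.

Lemma sqr_frob_le p (A : 'cV[R]_p) : frob A ^+ 2 <= p%:R * `|A| ^+ 2.
Proof.
have -> : p%:R * `|A| ^+ 2 = \sum_(i < p) `|A| ^+ 2.
  by rewrite sumr_const card_ord mulr_natl.
rewrite frobE ler_sum// => i _.
rewrite big_ord1 -[X in X <= _]real_normK ?num_real//.
by rewrite ler_pXn2r ?nnegrE// le_mx_entry.
Qed.

(** There are finitely many entries, so [filter_forall] merges their estimates into a single one on
    the max norm. *)
Lemma cvg_mx (X : Type) (F : set_system X) (FF : Filter F) p q
    (f : X -> 'M[R]_(p, q)) (l : 'M[R]_(p, q)) :
  (forall i j, f x i j @[x --> F] --> l i j) -> f @ F --> l.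
Proof.
move=> fl; apply/cvgrPdist_le => e e0.
have : \forall x \near F, forall i j, `|l i j - f x i j| <= e.
  apply: filter_forall => i; apply: filter_forall => j.
  by move/cvgrPdist_le : (fl i j); exact.
apply: filterS => x le; apply: mx_norm_le => [|i j]; first exact: ltW.
by rewrite !mxE.
Qed.

Lemma cvg_mx_coord (X : Type) (F : set_system X) (FF : Filter F) p q
    (f : X -> 'M[R]_(p, q)) (l : 'M[R]_(p, q)) i j :
  f @ F --> l -> f x i j @[x --> F] --> l i j.
Proof. by move=> fl; apply: (cvg_comp f (fun M => M i j) fl); exact: coord_continuous. Qed.

End MatrixNorm.

(** * Components of a parameter against its Euclidean norm *)

Section ParamNorm.
Context {R : realType} {n m : nat}.
Implicit Types w : param R n m.

Lemma wnorm_ge0 w : 0 <= wnorm w.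
Proof. exact: sqrtr_ge0. Qed.

Lemma wnorm_components w : [/\ `|wJ w| <= wnorm w, `|wR w| <= wnorm w,
  `|wQ w| <= wnorm w, `|wB w| <= wnorm w & `|wx0 w| <= wnorm w].
Proof.
have sq k : 0 <= k -> k ^+ 2 <= frob (wJ w) ^+ 2 + frob (wR w) ^+ 2
    + frob (wQ w) ^+ 2 + frob (wB w) ^+ 2 + frob (wx0 w) ^+ 2 -> k <= wnorm w.
  by move=> k0 h; rewrite -(ger0_norm k0) -sqrtr_sqr; exact: ler_wsqrtr.
split; apply: (le_trans (mx_norm_le_frob _)); apply: sq; rewrite ?frob_ge0//.
all: have := sqr_ge0 (frob (wJ w)); have := sqr_ge0 (frob (wR w)).
all: have := sqr_ge0 (frob (wQ w)); have := sqr_ge0 (frob (wB w)).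
all: have := sqr_ge0 (frob (wx0 w)); lra.
Qed.

End ParamNorm.

(** * Derivatives relative to [[0, T]] compared with two-sided ones *)

Section DeriveOn.
Context {R : realType}.
Implicit Types (T t : R) (f : R -> R).

Lemma slope_cvg_is_derive f t d :
  (s - t)^-1 *: (f s - f t) @[s --> t^'] --> d -> is_derive t 1 f d.
Proof.
move=> H.
suff K : h^-1 *: ((f \o shift t) (h *: (1 : R)) - f t) @[h --> 0^'] --> d.
  by split; [exact: (cvgP d) | apply/cvg_lim].
move=> A /H; rewrite /= /fmap /= /dnbhs /within /= => nA.
(* Substituting [s = h + t] passes from quotients at [s] near [t] to the increments [h] near 0 used
   by [is_derive]. *)
have : \forall h \near 0, h + t != t -> A ((h + t - t)^-1 *: (f (h + t) - f t)).
  have nA' : \forall s \near t, s != t -> A ((s - t)^-1 *: (f s - f t)) := nA.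
  by rewrite (near_shift 0) subr0 in nA'.
apply: filterS => h; rewrite addrK -subr_eq0 addrK => nA' h0.
by rewrite /= [h *: _]mulr1; exact: nA'.
Qed.

Lemma is_derive_slope_cvg f t d :
  is_derive t 1 f d -> (s - t)^-1 *: (f s - f t) @[s --> t^'] --> d.
Proof.
move=> -[df <-]; move: (df) => H A /H; rewrite /= /fmap /= /dnbhs /within /= => nA.
suff : \forall s \near t, s != t -> A ((s - t)^-1 *: (f s - f t)) by exact.
rewrite (near_shift 0) subr0.
near=> h; rewrite /= -subr_eq0 addrK => h0.
have : h != 0 -> A (h^-1 *: ((f \o shift t) (h *: (1 : R)) - f t)) by near: h.
by move=> /(_ h0); rewrite /= [h *: _]mulr1.
Unshelve. all: by end_near. Qed.

Lemma is_derive_on_coord T p q (f : R -> 'M[R]_(p, q)) t d i j :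
  is_derive_on T f t d -> is_derive_on T (fun s => f s i j) t (d i j).
Proof.
move=> H; have := @cvg_mx_coord R _ _ _ _ _ _ _ i j H.
rewrite /is_derive_on; suff -> : (fun s => (s - t)^-1 *: (f s i j - f t i j)) =
    (fun s => ((s - t)^-1 *: (f s - f t)) i j) by exact.
by apply/funext => s; rewrite !mxE.
Qed.

Lemma is_derive_on_mx T p q (f : R -> 'M[R]_(p, q)) t (d : 'M[R]_(p, q)) :
  (forall i j, is_derive t 1 (fun s => f s i j) (d i j)) -> is_derive_on T f t d.
Proof.
move=> H; apply: cvg_mx => i j; apply: cvg_within_filter.
have := is_derive_slope_cvg (H i j).
suff -> : (fun s => (s - t)^-1 *: (f s i j - f t i j)) =
    (fun s => ((s - t)^-1 *: (f s - f t)) i j) by exact.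
by apply/funext => s; rewrite !mxE.
Qed.

(** At an interior point [[0, T]] is a neighbourhood of [t], so the restriction to it does not
    affect the limit. *)
Lemma is_derive_on_is_derive T f t d : t \in `]0, T[ ->
  is_derive_on T f t d -> is_derive t 1 f d.
Proof.
move=> tT H; apply: slope_cvg_is_derive => A /H.
rewrite /= /fmap /= /dnbhs /within /= => nA.
have : \forall s \near t, s \in `[0, T].
  by apply: filterS (near_in_itvoo tT) => s; apply: subset_itv_oo_cc.
by move=> nT; apply: filterS2 nT nA => s sT sA st; exact: sA.
Qed.

Lemma is_derive_on_cvg T f t d :
  is_derive_on T f t d -> f @ within `[0, T] (nbhs t) --> f t.
Proof.
move=> H.
(* The punctured limit suffices: at [s = t] the value is [f t] itself, which lies in each of its
   neighbourhoods. *)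
suff K : f s @[s --> within `[0, T] t^'] --> f t.
  move=> A nA.
  have nW : \forall s \near t, s != t -> s \in `[0, T] -> A (f s) := K A nA.
  suff : \forall s \near t, s \in `[0, T] -> A (f s) by exact.
  apply: filterS nW => s sA sT; have [->|st] := eqVneq s t.
    exact: nbhs_singleton.
  exact: sA.
(* For [s] different from [t], the left side is just [f s]. *)
have E : (s - t) * ((s - t)^-1 *: (f s - f t)) + f t @[s --> within `[0, T] t^'] -->
    (t - t) * d + f t.
  apply: cvgD; last exact: cvg_cst.
  apply: cvgM => //; apply: cvgB; last exact: cvg_cst.
  apply: cvg_within_filter; apply: cvg_within.
move: E; rewrite subrr mul0r add0r; apply: cvg_trans; apply: near_eq_cvg.
rewrite /dnbhs near_withinE near_withinE; near=> s => st _.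
by rewrite -[_ *: _]/(_ * _) mulrA divff ?subr_eq0// mul1r subrK.
Unshelve. all: by end_near. Qed.

End DeriveOn.

Arguments is_derive_on_coord {R T p q f t d} i j _.
Arguments is_derive_on_cvg {R T f t d} _.
Arguments is_derive_on_is_derive {R T f t d} _ _.

(** * Energy estimate and Gronwall bound for a forced linear system *)

Section Energy.
Context {R : realType}.

(** The left side is the derivative of the sum of squares along [z' = A z + r]. Termwise Young
    inequalities bound it: [2 z_i A_ij z_j <= a (z_i^2 + z_j^2)] and
    [2 z_i r_i <= z_i^2 + rho^2]. *)
Lemma energy_le n (A : 'M[R]_n) (z r : 'cV[R]_n) a rho :
  `|A| <= a -> `|r| <= rho ->
  \sum_i (z i 0 *+ 2 * (A *m z + r) i 0) <=
  ((n%:R * a) *+ 2 + 1) * \sum_i z i 0 ^+ 2 + n%:R * rho ^+ 2.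
Proof.
move=> Aa rrho.
have a0 : 0 <= a by exact: le_trans Aa.
have two : \sum_(i < n) \sum_(j < n) (a * (z i 0 ^+ 2 + z j 0 ^+ 2)) =
    (n%:R * a) *+ 2 * \sum_i z i 0 ^+ 2.
  under eq_bigr do rewrite -mulr_sumr big_split/= sumr_const card_ord.
  rewrite -mulr_sumr big_split/= sumr_const card_ord sumrMnl.
  rewrite -mulr2n mulrnAr mulrnAr mulrnAl; congr (_ *+ 2).
  by rewrite -[LHS]mulr_natl mulrA.
have -> : n%:R * rho ^+ 2 = \sum_(i < n) rho ^+ 2.
  by rewrite sumr_const card_ord mulr_natl.
rewrite mulrDl mul1r -two -!big_split/= ler_sum// => i _.
have -> : z i 0 *+ 2 * (A *m z + r) i 0 =
    \sum_j (z i 0 *+ 2 * (A i j * z j 0)) + z i 0 *+ 2 * r i 0.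
  by rewrite !mxE mulrDr mulr_sumr.
rewrite -addrA lerD//.
  rewrite ler_sum// => j _.
  have := le_trans (le_mx_entry A i j) Aa; rewrite ler_norml => /andP[A1 A2].
  have := sqr_ge0 (z i 0 + z j 0); have := sqr_ge0 (z i 0 - z j 0).
  nra.
have /ler_normlP[r1 r2] := le_trans (le_mx_entry r i 0) rrho.
have := sqr_ge0 (z i 0 - r i 0).
nra.
Qed.

(** Gronwall's inequality, with the rate [K] supplied by [energy_le]. The factor [n.+1] is a crude
    substitute for the square root of [n] that arises in comparing the Euclidean and max norms. *)
Lemma linear_ode_bound n T (A : 'M[R]_n) (z r : R -> 'cV[R]_n) a rho :
  0 <= T -> `|A| <= a ->
  (forall t, t \in `[0, T] -> `|r t| <= rho) ->
  (forall t, t \in `[0, T] -> is_derive_on T z t (A *m z t + r t)) ->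
  forall t, t \in `[0, T] ->
    `|z t| <= expR (((n%:R * a) *+ 2 + 1) * T) * n.+1%:R * (`|z 0| + rho).
Proof.
move=> T0 Aa rrho dz t tT; set K := _ + 1.
have a0 : 0 <= a by exact: le_trans Aa.
have K0 : 0 <= K by rewrite addr_ge0// mulrn_wge0// mulr_ge0.
have rho0 : 0 <= rho by exact: le_trans (rrho _ tT).
pose S t := \sum_i z t i 0 ^+ 2.
pose phi t := expR (- K * t) * (S t + n%:R * rho ^+ 2).
have dS s : s \in `]0, T[ -> is_derive s 1 S (\sum_i (z s i 0 *+ 2 * (A *m z s + r s) i 0)).
  move=> sT; have sT' : s \in `[0, T] by exact: subset_itv_oo_cc sT.
  have dzi i := is_derive_on_is_derive sT (is_derive_on_coord i 0 (dz s sT')).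
  have -> : S = \sum_(i < n) (fun t => z t i 0 ^+ 2).
    by apply/funext => x; rewrite fct_sumE.
  apply: is_derive_sum => i.
  by apply: is_derive_eq; rewrite -mulr2n mulrnAl.
have dphi s : s \in `]0, T[ -> is_derive s 1 phi
   (expR (- K * s) * (\sum_i (z s i 0 *+ 2 * (A *m z s + r s) i 0) - K * (S s + n%:R * rho ^+ 2))).
  move=> /dS dSs; rewrite /phi; apply: is_derive_eq.
  rewrite !addr0 -![_ *: _]/(_ * _); ring.
(* At 0 and [T] only relative derivatives are available; continuity up to the endpoints lets the
   sign of the derivative on the open interval decide monotonicity. *)
have cphi : {within `[0, T], continuous phi}.
  apply/subspace_continuousP => s sT; rewrite /phi.
  apply: cvgM.
    apply: continuous_cvg; first exact: continuous_expR.
    by apply: cvgM; [exact: cvg_cst|apply: cvg_within].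
  apply: cvgD; last exact: cvg_cst.
  apply: (@cvg_big _ _ +%R) => // [|i _].
    exact: add_continuous.
  by apply: cvgM; apply: is_derive_on_cvg (is_derive_on_coord i 0 (dz s sT)).
have phi_le : phi t <= phi 0.
  move: tT; rewrite in_itv/= => /andP[t0 tT].
  apply: (ler0_derive1_nincr _ _ cphi (lexx 0) t0 tT) => s ds.
    by have [] := dphi _ ds.
  have ? := dphi _ ds.
  rewrite derive1E derive_val pmulr_rle0 ?expR_gt0// subr_le0.
  have sT : s \in `[0, T].
    by move: ds; rewrite !in_itv/= => /andP[/ltW-> /ltW->].
  (* The forcing term [n rho^2] is absorbed by [K * (n rho^2)], because [K >= 1]. *)
  rewrite (le_trans (energy_le _ Aa (rrho _ sT)))// mulrDr lerD2l ler_peMl//.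
  by rewrite mulr_ge0// sqr_ge0.
  by rewrite /K lerDr mulrn_wge0// mulr_ge0.
have S0 : S 0 <= n%:R * `|z 0| ^+ 2.
  have -> : S 0 = frob (z 0) ^+ 2.
    by rewrite frobE; apply: eq_bigr => i _; rewrite big_ord1.
  exact: sqr_frob_le.
have E0 : 0 <= expR (K * T) * n.+1%:R by rewrite mulr_ge0// ltW// expR_gt0.
have c0 : 0 <= expR (K * T) * n.+1%:R * (`|z 0| + rho).
  by rewrite mulr_ge0// addr_ge0.
have St : S t <= expR (K * T) * (n%:R * (`|z 0| ^+ 2 + rho ^+ 2)).
  move: phi_le; rewrite /phi mulr0 expR0 mul1r mulNr expRN mulrC ler_pdivrMr ?expR_gt0// => h.
  rewrite -(lerD2r (n%:R * rho ^+ 2)) in S0.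
  have Kt : expR (K * t) <= expR (K * T).
    by rewrite ler_expR ler_wpM2l//; move: tT; rewrite in_itv/= => /andP[].
  rewrite (@le_trans _ _ (S t + n%:R * rho ^+ 2))// ?lerDl ?mulr_ge0 ?sqr_ge0//.
  rewrite (le_trans h)// mulrC ler_pM ?expR_ge0//.
    rewrite addr_ge0 ?mulr_ge0 ?sqr_ge0// sumr_ge0// => k _; exact: sqr_ge0.
  by rewrite mulrDr.
apply: mx_norm_le => // i j; rewrite ord1.
rewrite -(@ler_pXn2r _ 2)// ?nnegrE// real_normK ?num_real//.
apply: (@le_trans _ _ (S t)).
  by rewrite /S (bigD1 i)//= lerDl sumr_ge0// => k _; exact: sqr_ge0.
apply: (le_trans St).
(* The target bound is squared, so it remains to compare factor by factor: [expR (K * T)] is at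
   least 1 and hence below its square, and [n <= n.+1 ^ 2]. *)
rewrite !exprMn -mulrA.
have E1 : 1 <= expR (K * T) by rewrite -expR0 ler_expR mulr_ge0.
rewrite ler_pM ?expR_ge0//.
- by rewrite mulr_ge0// addr_ge0 ?sqr_ge0.
- by rewrite expr2 ler_peMl// expR_ge0.
have nn : n%:R <= n.+1%:R ^+ 2 :> R.
  by rewrite -natrX ler_nat (leq_trans (leqnSn n))// -[X in (X <= _)%N]expn1 leq_pexp2l.
rewrite ler_pM// ?addr_ge0 ?sqr_ge0//.
have := normr_ge0 (z 0); nra.
Qed.

End Energy.

(** * Classical derivatives as weak derivatives, and bounds on the H^1 norm *)

Section WeakDerivative.
Context {R : realType}.
Notation mu := (@lebesgue_measure R).

Lemma within_continuous_integrable_oo (T : R) (f : R -> R) :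
  {within `[0, T], continuous f} -> mu.-integrable `]0, T[ (EFin \o f).
Proof.
move=> cf; apply: (@integrableS _ _ _ mu `[0, T]) => //.
  exact: subset_itv_oo_cc.
by apply: continuous_compact_integrable => //; exact: segment_compact.
Qed.

Lemma Rintegral_itv_oo_cc (T : R) (f : R -> R) :
  {within `[0, T], continuous f} ->
  \int[mu]_(t in `]0, T[) f t = \int[mu]_(t in `[0, T]) f t.
Proof.
move=> cf; rewrite /Rintegral; congr fine; apply/esym/integral_itv_bndoo.
exact: (measurable_int mu (within_continuous_integrable_oo cf)).
Qed.

Lemma test_function_derivable (T : R) (phi : R -> R) t :
  test_function T phi -> derivable phi t 1.
Proof. by move=> [/(_ 0%N t)]. Qed.

Lemma test_function_continuous (T : R) (phi : R -> R) :
  test_function T phi -> continuous phi.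
Proof.
move=> tphi t; apply/differentiable_continuous/derivable1_diffP.
exact: test_function_derivable tphi.
Qed.

Lemma test_function_derive1_continuous (T : R) (phi : R -> R) :
  test_function T phi -> continuous (derive1 phi).
Proof.
move=> [/(_ 1%N) dphi _] t; apply/differentiable_continuous/derivable1_diffP.
exact: dphi.
Qed.

Lemma is_derive_on_weak_derivative (T : R) (f g : R -> R) : 0 < T ->
  (forall t, t \in `[0, T] -> is_derive_on T f t (g t)) ->
  {within `[0, T], continuous g} -> weak_derivative T f g.
Proof.
move=> T0 dfg cg.
have cf : {within `[0, T], continuous f}.
  by apply/subspace_continuousP => t tT; exact: is_derive_on_cvg (dfg _ tT).
have df t : t \in `]0, T[ -> is_derive t 1 f (g t).
  move=> tT; apply: (is_derive_on_is_derive tT); apply: dfg.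
  exact: subset_itv_oo_cc.
have LI (h : R -> R) : {within `[0, T], continuous h} -> locally_integrable `]0, T[ h.
  move=> ch; apply: open_integrable_locally; first exact: interval_open.
  exact: within_continuous_integrable_oo.
split; [exact: LI|exact: LI|move=> phi tphi].
have cphi := test_function_continuous tphi.
have cdphi := test_function_derive1_continuous tphi.
have cM (h k : R -> R) : {within `[0, T], continuous h} -> continuous k ->
    {within `[0, T], continuous (fun t => h t * k t)}.
  move=> ch ck t; apply: continuousM; first exact: ch.
  exact: (continuous_subspaceT ck).
(* Integration by parts is available on the closed interval; adding the endpoints does not change
   the integrals. *)
rewrite !Rintegral_itv_oo_cc; [|exact: cM..].
have [cf1 cf2 cf3] := (continuous_within_itvP f T0).1 cf.
rewrite (@Rintegration_by_parts _ f phi g (derive1 phi))//.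
(* The boundary terms vanish: the support of [phi] lies in [[a, b]] with [0 < a] and [b < T]. *)
- have [_ [a [b [a0 bT phi0]]]] := tphi.
  rewrite !phi0 ?mulr0 ?subrr ?sub0r//.
    by rewrite in_itv/= negb_and -!ltNge a0.
  by rewrite in_itv/= negb_and -!ltNge bT orbT.
- by split=> // t /df[].
- by move=> t /df dft; rewrite derive1E derive_val.
- exact: continuous_subspaceT.
- split=> [t _||]; first exact: test_function_derivable tphi.
  + by apply: cvg_at_right_filter; exact: cphi.
  + by apply: cvg_at_left_filter; exact: cphi.
Qed.

(** [H1norm] is an infimum over weak derivatives, so the single candidate [g] gives an upper bound.
    Its integrand is at most [2 n c^2] on an interval of length [T]. *)
Lemma H1norm_le n (T c : R) (f g : R -> 'cV[R]_n) : 0 < T -> 0 <= c ->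
  (forall t, t \in `[0, T] -> is_derive_on T f t (g t)) ->
  {within `[0, T], continuous g} ->
  (forall t, t \in `[0, T] -> `|f t| <= c) ->
  (forall t, t \in `[0, T] -> `|g t| <= c) ->
  (H1norm T f <= (Num.sqrt ((n%:R * T) *+ 2) * c)%:E)%E.
Proof.
move=> T0 c0 dfg cg fc gc.
have wd i : weak_derivative T (fun t => f t i 0) (fun t => g t i 0).
  apply: is_derive_on_weak_derivative => // t.
    by move=> /dfg dt; exact: is_derive_on_coord dt.
  by apply: cvg_mx_coord; exact: cg.
pose h t := frob (f t) ^+ 2 + frob (g t) ^+ 2.
pose I := (\int[mu]_(t in `]0%R, T[) (h t)%:E)%E.
have I0 : (0 <= I)%E.
  by apply: integral_ge0 => t _; rewrite lee_fin addr_ge0 ?sqr_ge0.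
have Ile : (I <= ((n%:R * c ^+ 2) *+ 2 * T)%:E)%E.
  have -> : ((n%:R * c ^+ 2) *+ 2 * T)%:E =
      (\int[mu]_(t in `]0%R, T[) (cst ((n%:R * c ^+ 2) *+ 2)%:E t))%E.
    rewrite integral_cst//= lebesgue_measure_itv/= lte_fin T0.
    by rewrite -EFinD subr0 -EFinM.
  (* Measurability is read off from the local integrability contained in [weak_derivative]. *)
  have mcoord (k : R -> 'cV[R]_n) :
    (forall i, locally_integrable `]0, T[ (fun t => k t i 0)) ->
    measurable_fun `]0%R, T[ (fun t => frob (k t) ^+ 2).
    move=> lk.
    have -> : (fun t => frob (k t) ^+ 2) = (fun t => \sum_i \sum_j k t i j ^+ 2).
      by apply/funext => t; exact: frobE.
    apply: measurable_sum => i; apply: measurable_sum => j.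
    by rewrite ord1; apply: measurable_funX; case: (lk i).
  apply: ge0_le_integral => //.
  - by move=> t _; rewrite lee_fin addr_ge0 ?sqr_ge0.
  - apply/measurable_EFinP; apply: measurable_funD; apply: mcoord => i;
      by case: (wd i).
  - move=> t /subset_itv_oo_cc tT; rewrite lee_fin mulr2n lerD//.
      rewrite (le_trans (sqr_frob_le _))// ler_wpM2l// ler_pXn2r// ?nnegrE//.
      exact: fc.
    rewrite (le_trans (sqr_frob_le _))// ler_wpM2l// ler_pXn2r// ?nnegrE//.
    exact: gc.
apply: (@le_trans _ _ (I `^ 2^-1)%E).
  by apply: ereal_inf_lbound; exists g.
have -> : Num.sqrt ((n%:R * T) *+ 2) * c = ((n%:R * c ^+ 2) *+ 2 * T) `^ 2^-1.
  rewrite powR12_sqrt ?mulr_ge0 ?mulrn_wge0 ?mulr_ge0 ?sqr_ge0 ?(ltW T0)//.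
  rewrite -[X in _ * X](ger0_norm c0) -sqrtr_sqr -sqrtrM; last first.
    by rewrite mulrn_wge0// mulr_ge0// ltW.
  congr Num.sqrt; ring.
rewrite -poweR_EFin; apply: gt0_ler_poweR => //.
  by rewrite in_itv/= I0 leey.
by rewrite in_itv/= leey andbT lee_fin mulr_ge0 ?mulrn_wge0 ?mulr_ge0 ?sqr_ge0 ?(ltW T0).
Qed.

End WeakDerivative.

(** * Limits and derivatives of matrix products *)

Section MatrixCalculus.
Context {R : realType}.

Lemma cvg_mulmx (X : Type) (F : set_system X) (FF : Filter F) p q r
    (f : X -> 'M[R]_(p, q)) (g : X -> 'M[R]_(q, r)) (a : 'M[R]_(p, q)) (b : 'M[R]_(q, r)) :
  f @ F --> a -> g @ F --> b -> f x *m g x @[x --> F] --> a *m b.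
Proof.
move=> fa gb; apply: cvg_mx => i j; rewrite mxE.
under eq_fun do rewrite mxE.
apply: (@cvg_big _ _ +%R) => // [|k _]; first exact: add_continuous.
by apply: cvgM; apply: cvg_mx_coord.
Qed.

Lemma is_derive_mulmx p q r (f : R -> 'M[R]_(p, q)) (g : R -> 'M[R]_(q, r))
    (df : 'M[R]_(p, q)) (dg : 'M[R]_(q, r)) (t : R) :
  (forall i j, is_derive t 1 (fun s => f s i j) (df i j)) ->
  (forall i j, is_derive t 1 (fun s => g s i j) (dg i j)) ->
  forall i j, is_derive t 1 (fun s => (f s *m g s) i j)
    ((df *m g t + f t *m dg) i j).
Proof.
move=> hf hg i j.
have -> : (fun s => (f s *m g s) i j) =
    \sum_(k < q) (fun s => f s i k * g s k j).
  by apply/funext => s; rewrite fct_sumE mxE.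
have -> : (df *m g t + f t *m dg) i j =
    \sum_(k < q) (f t i k * dg k j + g t k j * df i k).
  rewrite !mxE addrC -big_split/=; apply: eq_bigr => k _.
  by rewrite [X in _ + X]mulrC.
by apply: is_derive_sum => k; exact: is_deriveM.
Qed.

Lemma is_derive_mx_continuous p q (f : R -> 'M[R]_(p, q)) (df : R -> 'M[R]_(p, q)) :
  (forall (t : R) i j, is_derive t 1 (fun s => f s i j) (df t i j)) -> continuous f.
Proof.
move=> dfE t; apply: cvg_mx => i j.
have [+ _] := dfE t i j.
by move=> /derivable1_diffP /differentiable_continuous.
Qed.

End MatrixCalculus.

(** * The matrix exponential by entrywise power series, and its inverse *)

Section MatrixExponential.
Context {R : realType} {n : nat}.
Implicit Types (A D : 'M[R]_n) (t : R).

Definition exp_coef A D i j k : R := (D *m A ^+ k) i j / k`!%:R.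

(* [D e^(t A)]; the left factor makes the family stable under derivation. *)
Definition expmx A D (t : R) : 'M[R]_n :=
  \matrix_(i, j) limn (pseries (exp_coef A D i j) t).

Lemma mx_normX_le A k : `|A ^+ k| <= (n%:R * `|A|) ^+ k.
Proof.
elim: k => [|k ih].
  rewrite !expr0; apply: mx_norm_le => // i j.
  by rewrite (_ : (1 : 'M[R]_n) = 1%:M)// mxE; case: (i == j); rewrite ?normr1 ?normr0.
rewrite !exprS (le_trans (mx_normM_le _ _))//.
by rewrite ler_wpM2l// mulr_ge0.
Qed.

Lemma is_cvg_exp_coef A D i j t : cvgn (pseries (exp_coef A D i j) t).
Proof.
apply: normed_cvg.
(* Domination by [n |D|] times the real exponential series at [n |A| |t|]. *)
apply: (@series_le_cvg _ _
  ((n%:R * `|D|) *: exp_coeff (n%:R * `|A| * `|t|))) => [k|k|k|].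
- exact: normr_ge0.
- by rewrite mulr_ge0 ?mulr_ge0// exp_coeff_ge0// !mulr_ge0.
- rewrite /= /exp_coef !normrM normfV (ger0_norm (ler0n _ _)) normrX mulrAC.
  rewrite [leRHS](_ : _ = n%:R * `|D| * (n%:R * `|A|) ^+ k * `|t| ^+ k / k`!%:R); last first.
    by rewrite -[LHS]/(n%:R * `|D| * (_ / _)) exprMn !mulrA.
  rewrite ler_wpM2r ?invr_ge0// ler_wpM2r ?exprn_ge0//.
  rewrite (le_trans (le_mx_entry _ _ _))// (le_trans (mx_normM_le _ _))//.
  by rewrite ler_wpM2l ?mulr_ge0// mx_normX_le.
- exact/is_cvg_seriesZ/is_cvg_series_exp_coeff.
Qed.

(** The factor [k + 1] from differentiation cancels against [(k + 1)!], and the extra power of [A]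
    is moved into the left factor [D]. *)
Lemma pseries_diffs_exp_coef A D i j :
  pseries_diffs (exp_coef A D i j) = exp_coef A (D *m A) i j.
Proof.
apply/funext => k; rewrite /pseries_diffs /exp_coef exprS mulmxA factS natrM.
by rewrite invfM mulrCA mulVKf// pnatr_eq0.
Qed.

Lemma is_derive_expmx_coord A D i j t :
  is_derive t 1 (fun s => expmx A D s i j) (expmx A (D *m A) t i j).
Proof.
have -> : (fun s => expmx A D s i j) =
    (fun s => limn (pseries (exp_coef A D i j) s)).
  by apply/funext => s; rewrite mxE.
rewrite mxE -pseries_diffs_exp_coef.
(* Termwise differentiation needs the series and its first two formal derivatives to converge at
   some point beyond [|t|]; all three belong to the same family. *)
apply: (@pseries_snd_diffs _ _ (`|t| + 1)).
- exact: is_cvg_exp_coef.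
- by rewrite pseries_diffs_exp_coef; exact: is_cvg_exp_coef.
- by rewrite !pseries_diffs_exp_coef; exact: is_cvg_exp_coef.
- by rewrite [ltRHS]ger0_norm// ltrDl.
Qed.

(** Left multiplication by [D] commutes with partial sums and is continuous. With [D = A] this turns
    the derivative [expmx A A] into [A] times the exponential. *)
Lemma expmxE A D t : expmx A D t = D *m expmx A 1 t.
Proof.
pose S D' N : 'M[R]_n := \matrix_(i, j) pseries (exp_coef A D' i j) t N.
have SE D' : S D' @ \oo --> expmx A D' t.
  apply: cvg_mx => i j; rewrite mxE; under eq_fun do rewrite mxE.
  exact: is_cvg_exp_coef.
suff SD : S D @ \oo --> D *m expmx A 1 t.
  by apply: cvg_unique (SE D) SD.
have -> : S D = (fun N => D *m S 1 N).
  apply/funext => N; apply/matrixP => i j; rewrite !mxE /pseries /series/=.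
  under [RHS]eq_bigr do rewrite mxE mulr_sumr.
  rewrite exchange_big/=; apply: eq_bigr => k _.
  rewrite /exp_coef mxE !mulr_suml; apply: eq_bigr => l _.
  by rewrite mul1mx !mulrA.
by apply: cvg_mulmx => //; exact: cvg_cst.
Qed.

Lemma expmx0 A D : expmx A D 0 = D.
Proof.
apply/matrixP => i j; rewrite mxE.
(* The partial sum of index 0 is empty; every later one retains only the constant term. *)
have -> : pseries (exp_coef A D i j) 0 = fun N => if N is 0%N then 0 else D i j.
  apply/funext => -[|N]; rewrite /pseries /series/= ?big_nil// big_nat_recl//=.
  rewrite big1 => [|k _]; last by rewrite exprS mul0r mulr0.
  by rewrite /exp_coef expr0 mulmx1 divr1 mulr1 addr0.
apply/cvg_lim => //.
apply: (@cvg_trans _ (cst (D i j) @ \oo)); last exact: cvg_cst.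
by apply: near_eq_cvg; exists 1%N => // -[].
Qed.

Lemma is_derive_expmx A i j t :
  is_derive t 1 (fun s => expmx A 1 s i j) ((A *m expmx A 1 t) i j).
Proof. by have := is_derive_expmx_coord A 1 i j t; rewrite mul1mx expmxE. Qed.

(* Built on [A^T] so that its derivative is [- expmxV A t *m A], without having
   to commute [A] with its exponential. *)
Definition expmxV A t : 'M[R]_n := (expmx (- A^T) 1 t)^T.

Lemma is_derive_expmxV A i j t :
  is_derive t 1 (fun s => expmxV A s i j) ((- (expmxV A t *m A)) i j).
Proof.
have -> : (fun s => expmxV A s i j) = (fun s => expmx (- A^T) 1 s j i).
  by apply/funext => s; rewrite mxE.
have -> : - (expmxV A t *m A) = (- A^T *m expmx (- A^T) 1 t)^T.
  by rewrite mulNmx linearN/= trmx_mul trmxK.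
by rewrite mxE; exact: is_derive_expmx.
Qed.

Lemma mul_expmx_expmxV A t : expmx A 1 t *m expmxV A t = 1%:M.
Proof.
(* A left inverse of a square matrix is also a right inverse. In the flipped order the two terms of
   the product rule cancel, so the product keeps its value at 0. *)
apply: mulmx1C; apply/matrixP => i j.
have -> : (1%:M : 'M[R]_n) i j = (expmxV A 0 *m expmx A 1 0) i j.
  by rewrite /expmxV !expmx0 trmx1 mul1mx.
apply: (@is_derive_0_is_cst _ (fun s => (expmxV A s *m expmx A 1 s) i j)) => s.
have := is_derive_mulmx (fun i j => is_derive_expmxV A i j s)
  (fun i j => is_derive_expmx A i j s) i j.
by rewrite mulNmx mulmxA addNr mxE.
Qed.

End MatrixExponential.

(** * Existence by variation of constants *)

Section Existence.
Context {R : realType}.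
Notation mu := (@lebesgue_measure R).

(** For [0 <= T], the retraction of the line onto [[0, T]]; composing with it extends a function
    continuous on [[0, T]] to a continuous one on the line. *)
Definition clamp (T t : R) := Num.max 0 (Num.min t T).

Lemma clamp_in (T t : R) : 0 <= T -> clamp T t \in `[0, T].
Proof. by move=> T0; rewrite in_itv/= le_max lexx/= ge_max T0 ge_min lexx orbT. Qed.

Lemma clamp_id (T t : R) : t \in `[0, T] -> clamp T t = t.
Proof. by rewrite in_itv/= /clamp => /andP[t0 tT]; rewrite min_l// max_r. Qed.

Lemma continuous_clamp (T : R) (V : topologicalType) (f : R -> V) : 0 <= T ->
  {within `[0, T], continuous f} -> continuous (f \o clamp T).
Proof.
move=> T0 /subspace_continuousP cf t.
have ct : {for t, continuous (clamp T)}.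
  by apply: continuous_max; [exact: cst_continuous|
    apply: continuous_min; [exact: cvg_id|exact: cst_continuous]].
apply: (cvg_comp (clamp T) f _ (cf _ (clamp_in t T0))).
move=> A /ct nA.
have nA' : \forall s \near t, clamp T s \in `[0, T] -> A (clamp T s) := nA.
suff : \forall s \near t, A (clamp T s) by exact.
by apply: filterS nA' => s; apply; exact: clamp_in.
Qed.

Lemma primitive_exists (a : R) (h : R -> R) : continuous h ->
  exists2 v : R -> R, v a = 0 &
    forall t, a <= t -> is_derive t 1 v (h t).
Proof.
move=> ch.
(* Integration starts at [a - 1], so that [t = a] is interior and the derivative there is two-sided;
   subtracting [v a] then restores the value 0 at [a]. *)
pose v t := \int[mu]_(s in `[a - 1, t]) h s.
exists (fun t => v t - v a) => [|t at_]; first by rewrite subrr.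
have int : mu.-integrable `[a - 1, t + 1] (EFin \o h).
  apply: continuous_compact_integrable; first exact: segment_compact.
  exact: continuous_subspaceT.
have [dv v'] : derivable v t 1 /\ derive1 v t = h t.
  apply: (@continuous_FTC1_closed _ _ _ _ (t + 1)) => //.
  - by rewrite ltrDl.
  - by rewrite (lt_le_trans _ at_)// ltrBlDr ltrDl.
  - exact: ch.
have dv' : is_derive t 1 v (h t).
  by split; [exact: dv|rewrite -derive1E].
have := is_deriveB dv' (is_derive_cst (v a) t 1).
by rewrite subr0.
Qed.

Lemma linear_ode_exists n (T : R) (A : 'M[R]_n) (b : R -> 'cV[R]_n) (x0 : 'cV[R]_n) :
  continuous b ->
  exists x : R -> 'cV[R]_n, [/\ x 0 = x0,
    {within `[0, T], continuous x} &
    forall t, t \in `[0, T] -> is_derive_on T x t (A *m x t + b t)].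
Proof.
move=> cb.
pose h t := expmxV A t *m b t.
have ch i : continuous (fun t => h t i 0).
  move=> t; apply: cvg_mx_coord; apply: cvg_mulmx; last exact: cb.
  have := @is_derive_mx_continuous _ _ _ (expmxV A) (fun t => - (expmxV A t *m A)).
  by apply => s k l; exact: is_derive_expmxV.
have /choice[v vP] : forall i : 'I_n, exists v : R -> R, v 0 = 0 /\
    forall t : R, 0 <= t -> is_derive t 1 v (h t i 0).
  by move=> i; have [v v0 dv] := primitive_exists 0 (ch i); exists v.
pose y t : 'cV[R]_n := \col_i (x0 i 0 + v i t).
pose x t := expmx A 1 t *m y t.
have dx t : t \in `[0, T] -> is_derive_on T x t (A *m x t + b t).
  rewrite in_itv/= => /andP[t0 _]; apply: is_derive_on_mx => i j.
  (* The right side has the shape of the product rule for [x]; the exponential and its inverse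
     cancel in the second term and leave [b t]. *)
  have -> : A *m x t + b t = A *m expmx A 1 t *m y t + expmx A 1 t *m h t.
    by rewrite /x /h !mulmxA mul_expmx_expmxV mul1mx.
  apply: is_derive_mulmx => [k l|k l]; first exact: is_derive_expmx.
  rewrite ord1.
  have -> : (fun s => y s k 0) = (fun s => x0 k 0 + v k s).
    by apply/funext => s; rewrite mxE.
  have [_ /(_ _ t0) dv] := vP k.
  by have := is_deriveD (is_derive_cst (x0 k 0) t 1) dv; rewrite add0r.
exists x; split=> //.
- rewrite /x expmx0 mul1mx; apply/matrixP => i j.
  by rewrite mxE (vP i).1 addr0 ord1.
- apply/subspace_continuousP => t tT; apply: cvg_mx => i j.
  by have := is_derive_on_cvg (is_derive_on_coord i j (dx t tT)).
Qed.

Lemma ph_solution_exists n m (T : R) (u : R -> 'cV[R]_m) (w : param R n m) :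
  0 <= T -> {within `[0, T], continuous u} -> exists x, ph_solution T u w x.
Proof.
move=> T0 cu; pose b t := wB w *m u (clamp T t).
have cb : continuous b.
  by move=> t; apply: cvg_mulmx; [exact: cvg_cst|exact: continuous_clamp].
have [x [x0 cx dx]] := linear_ode_exists T ((wJ w - wR w) *m wQ w) (wx0 w) cb.
exists x; split=> //.
  exists (fun t => (wJ w - wR w) *m wQ w *m x t + b t) => //.
  move=> t; apply: cvgD; last exact: (continuous_subspaceT cb).
  by apply: cvg_mulmx; [exact: cvg_cst|exact: cx].
by move=> t tT; have := dx t tT; rewrite /b clamp_id.
Qed.

End Existence.

(** * Uniqueness and Lipschitz dependence on the parameters *)

Section Stability.
Context {R : realType}.

Lemma is_derive_onB (T : R) (V : normedModType R) (f g : R -> V) (t : R) (a b : V) :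
  is_derive_on T f t a -> is_derive_on T g t b ->
  is_derive_on T (fun s => f s - g s) t (a - b).
Proof.
move=> fa gb; rewrite /is_derive_on.
have -> : (fun s => (s - t)^-1 *: (f s - g s - (f t - g t))) =
    (fun s => (s - t)^-1 *: (f s - f t) - (s - t)^-1 *: (g s - g t)).
  by apply/funext => s; rewrite -scalerBr opprD addrACA -opprD.
exact: cvgB.
Qed.

Lemma ph_solution_continuous n m (T : R) (u : R -> 'cV[R]_m) (w : param R n m) x :
  ph_solution T u w x -> {within `[0, T], continuous x}.
Proof.
move=> [_ dx _]; apply/subspace_continuousP => t tT; apply: cvg_mx => i j.
by have := is_derive_on_cvg (is_derive_on_coord i j (dx t tT)).
Qed.

Definition sysmx n m (w : param R n m) : 'M[R]_n := (wJ w - wR w) *m wQ w.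

Lemma sysmx_norm_le n m (w : param R n m) N : wnorm w <= N ->
  `|sysmx w| <= n%:R * (N + N) * N.
Proof.
move=> wN; have [J1 R1 Q1 _ _] := wnorm_components w.
rewrite (le_trans (mx_normM_le _ _))// ler_pM ?mulr_ge0 ?ler_wpM2l ?(le_trans Q1)//.
by rewrite (le_trans (ler_normB _ _))// lerD// ?(le_trans J1) ?(le_trans R1).
Qed.

(** Telescoping: [A - A'] is the change of [J - R] times [Q] plus [J' - R'] times the change of [Q].
    Each product contributes [2 n N] times the distance of the parameters. *)
Lemma sysmxB_norm_le n m (w w' : param R n m) N : wnorm w <= N -> wnorm w' <= N ->
  `|sysmx w - sysmx w'| <= n%:R * (N *+ 4) * wnorm (w - w').
Proof.
move=> wN wN'; have [_ _ Q1 _ _] := wnorm_components w.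
have [J2 R2 _ _ _] := wnorm_components w'.
have [J3 R3 Q3 _ _] := wnorm_components (w - w').
have -> : sysmx w - sysmx w' =
    (wJ (w - w') - wR (w - w')) *m wQ w + (wJ w' - wR w') *m wQ (w - w').
  have -> : wJ (w - w') = wJ w - wJ w' by [].
  have -> : wR (w - w') = wR w - wR w' by [].
  have -> : wQ (w - w') = wQ w - wQ w' by [].
  by rewrite opprD addrACA -opprD mulmxBl mulmxBr subrKA.
set d := wnorm (w - w') in J3 R3 Q3 *.
have d0 : 0 <= d by exact: wnorm_ge0.
have N0 : 0 <= N by rewrite (le_trans _ wN)// wnorm_ge0.
have -> : n%:R * (N *+ 4) * d = n%:R * (d + d) * N + n%:R * (N + N) * d by ring.
rewrite (le_trans (ler_normD _ _))// lerD// (le_trans (mx_normM_le _ _))//.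
  rewrite ler_pM ?mulr_ge0 ?(le_trans Q1)// ler_wpM2l//.
  by rewrite (le_trans (ler_normB _ _))// lerD.
rewrite ler_pM ?mulr_ge0// ler_wpM2l//.
by rewrite (le_trans (ler_normB _ _))// lerD// ?(le_trans J2) ?(le_trans R2).
Qed.

(** Adding and subtracting [sysmx w *m x' t] leaves a system for the difference driven by [sysmx w],
    in which the parameter change appears only as forcing. *)
Lemma ph_solutionB n m (T : R) (u : R -> 'cV[R]_m) (w w' : param R n m) x x' :
  ph_solution T u w x -> ph_solution T u w' x' ->
  forall t, t \in `[0, T] -> is_derive_on T (fun s => x s - x' s) t
    (sysmx w *m (x t - x' t) +
      ((sysmx w - sysmx w') *m x' t + wB (w - w') *m u t)).
Proof.
move=> [_ dx _] [_ dx' _] t tT.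
have := is_derive_onB (dx t tT) (dx' t tT).
rewrite -/(sysmx w) -/(sysmx w'); congr is_derive_on.
have -> : wB (w - w') = wB w - wB w' by [].
rewrite mulmxBr !mulmxBl -[sysmx w *m x' t - _ + _]addrA subrKA.
by rewrite opprD addrACA -!addrA; congr (_ + _); rewrite addrCA.
Qed.

Lemma ph_solution_unique n m (T : R) (u : R -> 'cV[R]_m) (w : param R n m) x x' :
  0 <= T -> ph_solution T u w x -> ph_solution T u w x' ->
  forall t, t \in `[0, T] -> x t = x' t.
Proof.
move=> T0 sx sx' t tT; apply/eqP; rewrite -subr_eq0 -normr_le0.
(* Equal parameters make the forcing vanish. *)
have dz s : s \in `[0, T] -> is_derive_on T (fun s => x s - x' s) s
    (sysmx w *m (x s - x' s) + 0).
  move=> sT; have := ph_solutionB sx sx' sT.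
  have -> : wB (w - w) = wB w - wB w by [].
  by rewrite !subrr !mul0mx addr0.
have r0 s : s \in `[0, T] -> `|0 : 'cV[R]_n| <= 0 by rewrite normr0.
have := @linear_ode_bound _ _ T (sysmx w) (fun s => x s - x' s) (fun=> 0) _ 0
  T0 (lexx _) r0 dz t tT.
by have [_ _ ->] := sx; have [_ _ ->] := sx'; rewrite subrr normr0 addr0 mulr0.
Qed.

Lemma within_continuous_bounded (T : R) n (u : R -> 'cV[R]_n) :
  {within `[0, T], continuous u} ->
  exists2 U, 0 <= U & forall t, t \in `[0, T] -> `|u t| <= U.
Proof.
move=> cu; have := continuous_compact cu (@segment_compact _ 0 T).
move=> /compact_bounded[M [_ Mu]].
(* Boundedness is given for every constant strictly above [M]. *)
exists (`|M| + 1) => [|t tT]; first by rewrite addr_ge0.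
apply: Mu; last by exists t.
by rewrite (le_lt_trans (ler_norm _))// ltrDl.
Qed.

(** All constants are built from [n], [m], [T], [N] and a bound [U] on the input before any
    parameter is chosen, which makes [C] uniform on the ball of radius [N]. *)
Lemma ph_solution_stable n m (T : R) (u : R -> 'cV[R]_m) (N : R) :
  0 < T -> 0 <= N -> {within `[0, T], continuous u} ->
  exists2 C : R, 0 < C & forall w w' : param R n m,
    wnorm w <= N -> wnorm w' <= N -> forall x x' : R -> 'cV[R]_n,
    ph_solution T u w x -> ph_solution T u w' x' ->
    (H1norm T (fun t => (x t - x' t)%R) <= (C * wnorm (w - w'))%:E)%E.
Proof.
move=> T0 N0 cu; have [U U0 uU] := within_continuous_bounded cu.
(* With [d] the distance of the parameters: [a] bounds the system matrices, [c] is the resulting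
   Gronwall factor, [X] bounds [x'], [rho * d] the forcing and [Z * d] the difference [z]. *)
pose a : R := n%:R * (N + N) * N.
have a0 : 0 <= a by rewrite !mulr_ge0// addr_ge0.
pose c : R := expR (((n%:R * a) *+ 2 + 1) * T) * n.+1%:R.
have c0 : 0 <= c by rewrite mulr_ge0// expR_ge0.
pose X : R := c * (N + m%:R * N * U).
have X0 : 0 <= X by rewrite mulr_ge0// addr_ge0// !mulr_ge0.
pose rho : R := n%:R * (n%:R * (N *+ 4)) * X + m%:R * U.
have rho0 : 0 <= rho.
  have N4 : 0 <= N *+ 4 by rewrite mulrn_wge0.
  by rewrite addr_ge0//; [do 3 rewrite mulr_ge0//|rewrite mulr_ge0].
pose Z : R := c * (1 + rho).
have Z0 : 0 <= Z by rewrite mulr_ge0// addr_ge0.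
(* Chosen so that [D * d] bounds both [z] and its derivative: the first two summands serve the
   derivative, the last one [z]. *)
pose D : R := n%:R * a * Z + rho + Z.
have naZ : 0 <= n%:R * a * Z by do 2 rewrite mulr_ge0//.
have D0 : 0 <= D by do 2 rewrite addr_ge0//.
(* The summand 1 keeps the constant positive, for instance when [n = 0] and the square root
   vanishes. *)
exists (Num.sqrt ((n%:R * T) *+ 2) * D + 1).
  by rewrite ltr_wpDl// mulr_ge0// sqrtr_ge0.
move=> w w' wN wN' x x' sx sx'; set d := wnorm (w - w').
have d0 : 0 <= d by exact: wnorm_ge0.
have x'X t : t \in `[0, T] -> `|x' t| <= X.
  move=> tT; have [_ dx' x'0] := sx'.
  have [_ _ _ B' x0'] := wnorm_components w'.
  have Bu s : s \in `[0, T] -> `|wB w' *m u s| <= m%:R * N * U.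
    move=> sT; rewrite (le_trans (mx_normM_le _ _))// ler_pM ?mulr_ge0 ?uU//.
    by rewrite ler_wpM2l// (le_trans B').
  have := linear_ode_bound (ltW T0) (sysmx_norm_le wN') Bu dx' tT.
  move=> /le_trans; apply; rewrite -/a -/c /X ler_wpM2l// lerD2r x'0.
  exact: le_trans x0' wN'.
pose r t := (sysmx w - sysmx w') *m x' t + wB (w - w') *m u t.
have rr t : t \in `[0, T] -> `|r t| <= rho * d.
  move=> tT; have [_ _ _ B3 _] := wnorm_components (w - w').
  have -> : rho * d = n%:R * (n%:R * (N *+ 4) * d) * X + m%:R * d * U.
    by rewrite /rho; ring.
  rewrite (le_trans (ler_normD _ _))// lerD// (le_trans (mx_normM_le _ _))//.
    by rewrite ler_pM ?mulr_ge0 ?x'X// ler_wpM2l// sysmxB_norm_le.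
  by rewrite ler_pM ?mulr_ge0 ?uU// ler_wpM2l.
pose z t := x t - x' t.
have dz t : t \in `[0, T] -> is_derive_on T z t (sysmx w *m z t + r t).
  by move=> tT; exact: ph_solutionB.
have z0 : `|z 0| <= d.
  have [_ _ _ _] := wnorm_components (w - w'); rewrite /z.
  by have [_ _ ->] := sx; have [_ _ ->] := sx'.
have zZ t : t \in `[0, T] -> `|z t| <= Z * d.
  move=> tT; have := linear_ode_bound (ltW T0) (sysmx_norm_le wN) rr dz tT.
  move=> /le_trans; apply; rewrite -/a -/c /Z -mulrA ler_wpM2l//.
  by rewrite [(1 + rho) * d]mulrDl mul1r lerD2r.
have cx := ph_solution_continuous sx; have cx' := ph_solution_continuous sx'.
have H1 : (H1norm T z <= (Num.sqrt ((n%:R * T) *+ 2) * (D * d))%:E)%E.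
  apply: (@H1norm_le _ _ _ _ _ (fun t => sysmx w *m z t + r t)) => //.
  - by rewrite mulr_ge0.
  - move=> t; apply: cvgD.
      apply: cvg_mulmx; first exact: cvg_cst.
      by apply: cvgB; [exact: cx|exact: cx'].
    apply: cvgD; apply: cvg_mulmx; try exact: cvg_cst.
      exact: cx'.
    exact: cu.
  - move=> t tT; rewrite (le_trans (zZ t tT))// ler_wpM2r// /D lerDr.
    by rewrite addr_ge0.
  - move=> t tT; rewrite (le_trans (ler_normD _ _))//.
    rewrite (@le_trans _ _ (n%:R * a * (Z * d) + rho * d))//.
      rewrite lerD ?rr// (le_trans (mx_normM_le _ _))//.
      by rewrite ler_pM ?mulr_ge0 ?zZ// ler_wpM2l// sysmx_norm_le.
    by rewrite mulrA -mulrDl ler_wpM2r// /D lerDl.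
apply: (le_trans H1); rewrite lee_fin mulrA ler_wpM2r// lerDl//.
Qed.

End Stability.

(** A constant chosen after the pair would carry no information for distinct parameters, so [C] is
    fixed first, for all pairs of norm at most [M]; every pair is covered by some [M]. *)
Theorem lemma2 (R : realType) (n m : nat) (T : R) (hT : 0 < T)
    (Uad : set (param R n m)) (hUad : Uad `<=` @ph_param R n m)
    (u : R -> 'cV[R]_m) (hu : {within `[0, T], continuous u}) :
  (forall w, Uad w ->
     exists x : R -> 'cV[R]_n, ph_solution T u w x /\
       forall z : R -> 'cV[R]_n, ph_solution T u w z ->
         forall t, t \in `[0, T] -> z t = x t)
  /\
  (forall M : R, exists2 C : R, 0 < C &
     forall w w', Uad w -> Uad w' -> wnorm w <= M -> wnorm w' <= M ->
       forall x x' : R -> 'cV[R]_n,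
         ph_solution T u w x -> ph_solution T u w' x' ->
         (H1norm T (fun t => (x t - x' t)%R) <= (C * wnorm (w - w'))%:E)%E).
Proof.
split=> [w _|M].
  have [x sx] := ph_solution_exists w (ltW hT) hu.
  by exists x; split=> // z sz; exact: ph_solution_unique (ltW hT) sz sx.
(* The stability lemma takes a nonnegative radius, while [M] is an arbitrary real. *)
have [C C0 stable] := @ph_solution_stable R n m T u `|M| hT (normr_ge0 _) hu.
exists C => // w w' _ _ wM w'M x x' sx sx'.
by apply: stable; rewrite // (le_trans _ (ler_norm M)).
Qed.
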